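(* Let $V_1,\dots,V_k$ be finite nonempty sets with $\#V_l=n_l$, let $f:\mathcal P(V_1)\times\dots\times\mathcal P(V_k)\to\mathbb R$ (with $f(A_1,\dots,A_k)=0$ whenever some $A_i=\varnothing$), and let $f^M:\mathbb R^{n_1}\times\dots\times\mathbb R^{n_k}\to\mathbb R$ be its piecewise multilinear extension. Then the slice rank of $f$ equals the slice rank of $f^M$: $$\text{slice-rank}(f^M)=\text{slice-rank}(f).$$ Moreover, $\mathrm{rank}(f^M)=\mathrm{rank}(f)$ and $\text{slice-rank}(f)\le\mathrm{rank}(f)\le\#\mathrm{support}(f)$.
   Context: Piecewise multilinear extension: $$f^M(x^1,\dots,x^k)=\sum_{i_1=1}^{n_1}\cdots\sum_{i_k=1}^{n_k}\ \prod_{l=1}^k\big(x^l_{(i_l)}-x^l_{(i_l-1)}\big)\,f\big(V^{(i_1)}(x^1),\dots,V^{(i_k)}(x^k)\big),$$ where $x^l_{(1)}\le\dots\le x^l_{(n_l)}$ is the non-decreasing rearrangement of $x^l\in\mathbb R^{n_l}$, $x^l_{(0)}:=0$, $V^{(1)}(x^l)=V_l$, and $V^{(i)}(x^l)=\{j\in V_l:x^l_j>x^l_{(i-1)}\}$ for $i\ge2$. For nonempty sets $X_1,\dots,X_k$ and $F:X_1\times\dots\times X_k\to\mathbb R$: $F$ is a basic function if $F(x^1,\dots,x^k)=\prod_{i=1}^kF_i(x^i)$ for some $F_i:X_i\to\mathbb R$; $\mathrm{rank}(F)$ is the minimum number of basic functions needed to sum to $F$ ($\infty$ if there is no such representation).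 $F$ is a slice if, for some $i$, it is the product of a function on $X_i$ and a function on $\prod_{j\ne i}X_j$; $\text{slice-rank}(F)$ is the minimum number of slices needed to sum to $F$. $\mathrm{support}(f)$ is the set of tuples where $f\ne0$. *)

(* Defs.v *)
From HB Require Import structures.
From mathcomp Require Import all_boot all_order all_algebra.
From mathcomp Require Import all_classical all_reals.
From mathcomp Require Import ereal.

Set Implicit Arguments.
Unset Strict Implicit.
Unset Printing Implicit Defensive.

Import Order.TTheory GRing.Theory Num.Theory.
Local Open Scope ring_scope.

Definition basic_function (R : realType) (k : nat) (X : 'I_k -> Type)
    (F : (forall l, X l) -> R) : Prop :=
  exists Fl : forall l, X l -> R,
    forall x : forall l, X l, F x = \prod_(l < k) Fl l (x l).

Definition slice (R : realType) (k : nat) (X : 'I_k -> Type)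
    (F : (forall l, X l) -> R) : Prop :=
  exists (l : 'I_k) (g : X l -> R)
         (h : (forall m : {m : 'I_k | m != l}, X (val m)) -> R),
    forall x : forall l, X l, F x = g (x l) * h (fun m => x (val m)).

Definition sum_of (R : realType) (T : Type) (P : (T -> R) -> Prop)
    (F : T -> R) (n : nat) : Prop :=
  exists G : 'I_n -> T -> R,
    (forall i, P (G i)) /\ forall x, F x = \sum_(i < n) G i x.

(* The infimum of a nonempty set of naturals is its minimum, and that of the
   empty set is +oo. The zero function is the empty sum, so it has length 0. *)
Definition min_length (R : realType) (T : Type) (P : (T -> R) -> Prop)
    (F : T -> R) : \bar R :=
  ereal_inf [set (n%:R)%:E | n in [set n : nat | sum_of P F n]]%classic.

Definition rank (R : realType) (k : nat) (X : 'I_k -> Type)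
    (F : (forall l, X l) -> R) : \bar R :=
  min_length (@basic_function R k X) F.

Definition slice_rank (R : realType) (k : nat) (X : 'I_k -> Type)
    (F : (forall l, X l) -> R) : \bar R :=
  min_length (@slice R k X) F.

(* Tuples are taken in {dffun _} here because this copy of the product of the
   powersets is a finType, which allows one to count the support. *)
Definition set_support (R : realType) (k : nat) (V : 'I_k -> finType)
    (f : (forall l, {set V l}) -> R) : {set {dffun forall l : 'I_k, {set V l}}} :=
  [set A : {dffun forall l : 'I_k, {set V l}} | f (fun l => A l) != 0]%SET.

(* x_(i) is numbered from 1, with x_(0) = 0. *)
Definition rearrangement (R : realType) (V : finType) (x : V -> R) (i : nat) : R :=
  nth 0 (0 :: sort <=%R [seq x j | j <- enum V]) i.

Definition upper_set (R : realType) (V : finType) (x : V -> R) (i : nat) : {set V} :=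
  if (i <= 1)%N then [set: V]%SET
  else [set j | rearrangement x i.-1 < x j]%SET.

(* A vector of R^(n_l), n_l = #|V l|, is a function V l -> R. The summation
   index i l : 'I_#|V l| stands for i_l - 1. *)
Definition multilinear_extension (R : realType) (k : nat) (V : 'I_k -> finType)
    (f : (forall l, {set V l}) -> R) (x : forall l, V l -> R) : R :=
  \sum_(i : {dffun forall l : 'I_k, 'I_#|V l|})
    (\prod_(l < k) (rearrangement (x l) (i l).+1 - rearrangement (x l) (i l)))
    * f (fun l => upper_set (x l) (i l).+1).

(* Main.v *)
Require Import Defs.
From HB Require Import structures.
From mathcomp Require Import all_boot all_order all_algebra.
From mathcomp Require Import all_classical all_reals.
From mathcomp Require Import ereal.

Set Implicit Arguments.
Unset Strict Implicit.
Unset Printing Implicit Defensive.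

Import Order.TTheory GRing.Theory Num.Theory.
Local Open Scope ring_scope.

(** The extension M : f |-> f^M is linear in f, and composing with the map
    A |-> (1_(A_1), ..., 1_(A_k)) is a linear left inverse of M on the functions
    f that vanish as soon as one argument is empty
    ([multilinear_extension_indicator]).  A linear map that sends basic
    functions to basic functions can only shorten a decomposition, and likewise
    for slices ([le_min_length]); so both equalities follow once M and its left
    inverse are known to preserve the two classes.

    - M sends the product of the F_l to the product of their one-variable
      extensions, by distributivity ([basic_multilinear_extension]); for a slice
      at l, the sum over i_l splits off and is the extension of the factor that
      depends on A_l ([slice_multilinear_extension]).
    - The left inverse is a coordinatewise substitution, under which both
      classes are stable ([basic_comp], [slice_comp]).
    - f^M (1_A) = f A: the increasing rearrangement of an indicator takes the
      values 0, ..., 0, 1, ..., 1, so it has a single jump, of height 1 when the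
      set is nonempty, and the upper set at this jump is the set itself.

    The inequality between the two ranks holds because a basic function is a
    slice, and the bound by the support comes from writing f as the sum, over
    the B with f B != 0, of f B times the indicator of the point B, which is a
    product of functions of one argument. *)

(** * Decomposition lengths under linear maps *)

Lemma le_min_length (R : realType) (T U : Type) (P : (T -> R) -> Prop)
    (Q : (U -> R) -> Prop) (phi : (T -> R) -> U -> R) (F : T -> R) :
  (forall n (G : 'I_n -> T -> R) H, (forall x, H x = \sum_i G i x) ->
     forall y, phi H y = \sum_i phi (G i) y) ->
  (forall H, P H -> Q (phi H)) ->
  (min_length Q (phi F) <= min_length P F)%E.
Proof.
move=> phi_sum phiP; apply: ereal_inf_le_tmp => _ [n /= [G [PG FG]] <-].
exists n => //=; exists (fun i => phi (G i)); split=> [i|]; first exact: phiP.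
exact: phi_sum.
Qed.

(** * Sums over dependent finite functions *)

Lemma big_distr_dffun (R : comPzSemiRingType) (I : finType) (J : I -> finType)
    (F : forall i, J i -> R) :
  \prod_i \sum_(j : J i) F i j
    = \sum_(f : {dffun forall i, J i}) \prod_i F i (f i).
Proof.
pose F' i : {ffun J i -> R} := [ffun j => F i j].
transitivity (\prod_i \sum_(j : J i) F' i j).
  by apply: eq_bigr => i _; apply: eq_bigr => j _; rewrite ffunE.
under eq_bigr => i _ do rewrite (big_tag (fun i => F' i)).
rewrite bigA_distr_big_dep -big_fprod.
rewrite (reindex (@fprod_of_dffun I J)); last exact/onW_bij/fprod_of_dffun_bij.
by apply: eq_bigr => f _; apply: eq_bigr => i _; rewrite fprodE ffunE.
Qed.

(** Fubini for one distinguished coordinate.  Rather than introducing functions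
    on the complement of [i], the remaining coordinates are represented by the
    functions whose value at [i] is the base point [c]. *)
Lemma sum_dffun_split (R : nmodType) (I : finType) (J : I -> finType)
    (i : I) (c : J i) (G : {dffun forall m, J m} -> R) :
  \sum_f G f
    = \sum_(f : {dffun forall m, J m} | f i == c)
        \sum_(j : J i) G [ffun m : I => eqtype.dfwith f j m].
Proof.
pose upd (f : {dffun forall m, J m}) (j : J i) : {dffun forall m, J m} :=
  [ffun m => eqtype.dfwith f j m].
have upd_in f j : upd f j i = j by rewrite ffunE eqtype.dfwith_in.
have upd_out f j m : i != m -> upd f j m = f m.
  by move=> im; rewrite ffunE eqtype.dfwith_out.
rewrite (partition_big (upd^~ c) (fun f => f i == c)) => [|f _] /=; last first.
  by rewrite upd_in.
apply: eq_bigr => f /eqP fi.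
rewrite (reindex_onto (upd f) (fun g => g i)) /=; last first.
  move=> g /eqP <-; apply/ffunP => m.
  by have [<-|im] := eqVneq i m; rewrite ?upd_in // !upd_out.
apply: eq_bigl => j; rewrite upd_in eqxx andbT; apply/eqP/ffunP => m.
by have [<-|im] := eqVneq i m; rewrite ?upd_in // !upd_out.
Qed.

(** * The extension map preserves basic functions and slices *)

Definition jump (R : realType) (V : finType) (x : V -> R) (i : nat) : R :=
  rearrangement x i.+1 - rearrangement x i.

(** The one-variable case of the extension: the Choquet integral of [x] with
    respect to the set function [g]. *)
Definition choquet (R : realType) (V : finType) (g : {set V} -> R)
    (x : V -> R) : R :=
  \sum_(i < #|V|) jump x i * g (upper_set x i.+1).

Lemma multilinear_extension_sum (R : realType) (k : nat) (V : 'I_k -> finType)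
    n (G : 'I_n -> (forall l, {set V l}) -> R) F :
  (forall A, F A = \sum_i G i A) ->
  forall x, multilinear_extension F x = \sum_i multilinear_extension (G i) x.
Proof.
move=> FG x; rewrite exchange_big /=; apply: eq_bigr => i _.
by rewrite FG big_distrr.
Qed.

Lemma basic_multilinear_extension (R : realType) (k : nat)
    (V : 'I_k -> finType) (F : (forall l, {set V l}) -> R) :
  basic_function F -> basic_function (multilinear_extension F).
Proof.
case=> Fl FE; exists (fun l => choquet (Fl l)) => x.
rewrite /choquet big_distr_dffun; apply: eq_bigr => i _.
by rewrite FE -big_split.
Qed.

(** The new second factor is the sum over the indices other than [l], so that it
    involves only the restriction of [x] to the coordinates other than [l]. *)
Lemma slice_multilinear_extension (R : realType) (k : nat)
    (V : 'I_k -> finType) (V_gt0 : forall l, (0 < #|V l|)%N)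
    (F : (forall l, {set V l}) -> R) :
  slice F -> slice (multilinear_extension F).
Proof.
case=> l [g [h FE]]; pose c : 'I_#|V l| := Ordinal (V_gt0 l).
exists l, (choquet g), (fun y =>
  \sum_(i : {dffun forall m, 'I_#|V m|} | i l == c)
    (\prod_(m : {m | m != l}) jump (y m) (i (val m)))
    * h (fun m => upper_set (y m) (i (val m)).+1)) => x.
rewrite /multilinear_extension (sum_dffun_split c) big_distrr /=.
apply: eq_bigr => i _; rewrite /choquet big_distrl; apply: eq_bigr => j _ /=.
rewrite (bigD1 l) //= FE ffunE eqtype.dfwith_in -!mulrA; congr (_ * _).
rewrite mulrCA; congr (_ * _); congr (_ * _).
  rewrite -(big_sub [pred m | m != l] (fun m => jump (x m) (i m))).
  by apply: eq_bigr => m ml; rewrite ffunE eqtype.dfwith_out // eq_sym.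
congr h; apply: functional_extensionality_dep => -[m /= ml].
by rewrite ffunE eqtype.dfwith_out // eq_sym.
Qed.

(** * Basic functions as slices, and stability under substitution *)

Lemma basic_slice (R : realType) (k : nat) (X : 'I_k -> Type)
    (F : (forall l, X l) -> R) :
  (0 < k)%N -> basic_function F -> slice F.
Proof.
move=> k_gt0 [Fl FE]; pose l := Ordinal k_gt0.
exists l, (Fl l), (fun y => \prod_(m : {m | m != l}) Fl (val m) (y m)) => x.
rewrite FE (bigD1 l) //=; congr (_ * _).
exact: (big_sub [pred m | m != l] (fun m => Fl m (x m))).
Qed.

Section Pullback.
Variables (R : realType) (k : nat) (X Y : 'I_k -> Type).
Variables (u : forall l, Y l -> X l) (F : (forall l, X l) -> R).

Lemma basic_comp :
  basic_function F -> basic_function (fun y => F (fun l => u (y l))).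
Proof. by case=> Fl FE; exists (fun l => Fl l \o @u l) => y; rewrite FE. Qed.

Lemma slice_comp : slice F -> slice (fun y => F (fun l => u (y l))).
Proof.
case=> l [g [h FE]].
by exists l, (g \o @u l), (fun y => h (fun m => u (y m))) => y; rewrite FE.
Qed.

End Pullback.

(** * Evaluating the extension at indicators *)

Section Indicator.
Variables (R : realType) (V : finType).

Definition indicator (A : {set V}) (j : V) : R := (j \in A)%:R.

Lemma rearrangement_value (x : V -> R) (i : nat) :
  (i < #|V|)%N -> exists j, rearrangement x i.+1 = x j.
Proof.
move=> iV; have : rearrangement x i.+1 \in [seq x j | j <- enum V].
  rewrite -(mem_sort <=%R) /rearrangement /= mem_nth //.
  by rewrite size_sort size_map -cardE.
by case/mapP => j _ ->; exists j.
Qed.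

Lemma value_rearrangement (x : V -> R) (j : V) :
  exists2 i, (i < #|V|)%N & rearrangement x i.+1 = x j.
Proof.
have : x j \in sort <=%R [seq x j | j <- enum V].
  by rewrite mem_sort map_f // mem_enum.
by case/(nthP 0) => i; rewrite size_sort size_map -cardE => iV <-; exists i.
Qed.

(** Nonnegativity is what makes the sequence monotone from index 0 on, where its
    value is 0 by convention. *)
Lemma le_rearrangement (x : V -> R) (i i' : nat) : (forall j, 0 <= x j) ->
  (i <= i')%N -> (i' <= #|V|)%N -> rearrangement x i <= rearrangement x i'.
Proof.
move=> x0 ii' i'V; rewrite /rearrangement.
apply: (sorted_leq_nth le_trans lexx); rewrite ?inE /=.
- rewrite path_min_sorted ?sort_le_sorted // all_sort.
  by apply/allP => _ /mapP[j _ ->].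
- by rewrite size_sort size_map -cardE ltnS (leq_trans ii').
- by rewrite size_sort size_map -cardE ltnS.
- exact: ii'.
Qed.

Variable A : {set V}.

Lemma indicator_ge0 j : 0 <= indicator A j.
Proof. exact: ler0n. Qed.

Lemma rearrangement_indicator i : (i <= #|V|)%N ->
  rearrangement (indicator A) i = 0 \/ rearrangement (indicator A) i = 1.
Proof.
case: i => [|i iV]; first by left.
have [j ->] := rearrangement_value (indicator A) iV.
by rewrite /indicator; case: (j \in A); [right|left].
Qed.

(** A nonzero jump of a nondecreasing sequence of zeros and ones goes from 0 to
    1, so the upper set there consists of the [j] with [0 < indicator A j].  At
    [i = 0] the upper set is the whole of [V] by definition; there the first
    rearranged value, which is the minimum, is 1, hence [A] is the whole of [V]
    too. *)
Lemma upper_set_indicator i : (i < #|V|)%N -> jump (indicator A) i != 0 ->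
  upper_set (indicator A) i.+1 = A.
Proof.
move=> iV; rewrite /jump subr_eq0 => neq_r.
have le_r := le_rearrangement indicator_ge0 (leqnSn i) iV.
have [r0 r1] : rearrangement (indicator A) i = 0
    /\ rearrangement (indicator A) i.+1 = 1.
  move: neq_r le_r.
  have [->|->] := rearrangement_indicator (ltnW iV);
    have [->|->] := rearrangement_indicator iV; rewrite ?eqxx //.
  by rewrite ler10.
apply/setP => j; rewrite /upper_set;
  case: i => [|i] /= in iV neq_r le_r r0 r1 *.
  have [i' i'V xj] := value_rearrangement (indicator A) j.
  have := le_rearrangement indicator_ge0 (ltn0Sn i') i'V.
  by rewrite xj r1 /indicator inE; case: (j \in A) => //; rewrite ler10.
by rewrite !inE r0 /indicator ltr0n; case: (j \in A).
Qed.

(** The jumps telescope to the maximum of the indicator. *)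
Lemma sum_jump_indicator : A != finset.set0 ->
  \sum_(i < #|V|) jump (indicator A) i = 1.
Proof.
case/set0Pn => j jA.
rewrite -(big_mkord xpredT (jump (indicator A))) telescope_sumr //.
rewrite [rearrangement _ 0]/= subr0.
have [r0|//] := rearrangement_indicator (leqnn #|V|).
have [i iV xj] := value_rearrangement (indicator A) j.
have := le_rearrangement indicator_ge0 iV (leqnn _).
by rewrite xj r0 /indicator jA ler10.
Qed.

End Indicator.

(** Every nonzero summand carries the same value [f A], so the extension factors
    as [f A] times the product of the sums of jumps.  That product is 1 when no
    [A l] is empty, and otherwise [f A] is 0. *)
Lemma multilinear_extension_indicator (R : realType) (k : nat)
    (V : 'I_k -> finType) (f : (forall l, {set V l}) -> R) :
  (forall A : forall l, {set V l}, (exists l, A l = finset.set0) -> f A = 0) ->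
  forall A, multilinear_extension f (fun l => indicator R (A l)) = f A.
Proof.
move=> f0 A.
have -> : multilinear_extension f (fun l => indicator R (A l))
    = (\prod_l \sum_(i < #|V l|) jump (indicator R (A l)) i) * f A.
  rewrite big_distr_dffun big_distrl; apply: eq_bigr => i _ /=.
  have [prod0|/prodf_neq0 prodN0] :=
      eqVneq (\prod_l jump (indicator R (A l)) (i l)) 0.
    by rewrite [X in X * _]prod0 prod0 !mul0r.
  congr (_ * f _); apply: functional_extensionality_dep => l.
  by apply: upper_set_indicator => //; exact: prodN0.
have [[l Al]|AN0] := pselect (exists l, A l = finset.set0).
  by rewrite (f0 A) ?mulr0 //; exists l.
rewrite big1 ?mul1r // => l _; apply: sum_jump_indicator.
by apply/eqP => Al; apply: AN0; exists l.
Qed.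

(** * The support bound *)

Lemma rank_le_support (R : realType) (k : nat) (V : 'I_k -> finType)
    (f : (forall l, {set V l}) -> R) : (0 < k)%N ->
  (rank f <= (#|set_support f|%:R)%:E)%E.
Proof.
move=> k_gt0; apply: ereal_inf_lbound; exists #|set_support f| => //=.
pose D (B : {dffun forall l, {set V l}}) (A : forall l, {set V l}) : R :=
  f (fun l => B l) * \prod_l (A l == B l)%:R.
exists (fun i => D (enum_val i)); split=> [i|A].
  set B := enum_val i; pose l0 := Ordinal k_gt0.
  (* The scalar f B has to be absorbed by one of the factors, here the one at
     l0, which exists because k > 0. *)
  exists (fun l C => (if l == l0 then f (fun l => B l) else 1) * (C == B l)%:R).
  by move=> A; rewrite big_split /= -big_mkcond big_pred1_eq.
rewrite -(big_enum_val (fun B => D B A)) /=.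
pose A' : {dffun forall l, {set V l}} := [ffun l => A l].
have A'E : (fun l => A' l) = A.
  by apply: functional_extensionality_dep => l; rewrite ffunE.
have D0 B : B != A' -> D B A = 0.
  move=> BA; rewrite /D; have [l Al|AB] := pickP (fun l => A l != B l).
    by rewrite (bigD1 l) //= (negbTE Al) mul0r mulr0.
  case/eqP: BA; apply/ffunP => l; rewrite ffunE.
  by apply/esym/eqP/negbFE/AB.
have DA : D A' A = f A.
  by rewrite /D A'E big1 ?mulr1 // => l _; rewrite ffunE eqxx.
have [A'f|] := boolP (A' \in set_support f).
  by rewrite (bigD1 A') //= big1 ?addr0 // => B /andP[_]; exact: D0.
rewrite inE A'E negbK => /eqP fA; rewrite fA big1 // => B Bf; apply: D0.
by apply: contraTneq Bf => ->; rewrite inE A'E fA eqxx.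
Qed.

(** * Comparison of the ranks *)

Theorem proposition3p5 (R : realType) (k : nat) (k_gt0 : (0 < k)%N)
    (V : 'I_k -> finType) (V_gt0 : forall l, (0 < #|V l|)%N)
    (f : (forall l, {set V l}) -> R)
    (f0 : forall A : forall l, {set V l},
      (exists l, A l = finset.set0) -> f A = 0) :
  slice_rank (multilinear_extension f) = slice_rank f /\
  rank (multilinear_extension f) = rank f /\
  (slice_rank f <= rank f)%E /\
  (rank f <= (#|set_support f|%:R)%:E)%E.
Proof.
pose restr (F : (forall l, V l -> R) -> R) (A : forall l, {set V l}) :=
  F (fun l => indicator R (A l)).
have restrK : restr (multilinear_extension f) = f.
  by apply/funext; exact: multilinear_extension_indicator.
split; [|split; [|split]].
- apply/eqP; rewrite eq_le; apply/andP; split.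
    apply: le_min_length; first exact: multilinear_extension_sum.
    exact: slice_multilinear_extension.
  rewrite -[in leLHS]restrK.
  apply: (le_min_length (phi := restr)) => [n G H HG A|F].
    exact: HG.
  exact: (slice_comp (fun l => @indicator R (V l))).
- apply/eqP; rewrite eq_le; apply/andP; split.
    apply: le_min_length; first exact: multilinear_extension_sum.
    exact: basic_multilinear_extension.
  rewrite -[in leLHS]restrK.
  apply: (le_min_length (phi := restr)) => [n G H HG A|F].
    exact: HG.
  exact: (basic_comp (fun l => @indicator R (V l))).
- apply: (le_min_length (phi := id)) => // F; exact: basic_slice.
- exact: rank_le_support.
Qed.
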